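(* Let $\eta\in\mathcal{P}$ be fixed. Let $y^j(\eta)$ be an approximation of the solution $y(t^j,\eta)$, at time $t^j$, $j=1,\dots,N_t$, of the full order system $\dot y=J_{2n}\nabla_y\mathcal{H}(y,\eta)$, $y(t_0,\eta)=y^0(\eta)$, obtained with a user-defined numerical time integrator. Similarly, let $z^j(\eta)$ be an approximation of the solution $z(t^j,\eta)$, at time $t^j$, of the hyper-reduced system $\dot z=J_{2k}\nabla_z\mathcal{H}_{hr}(z,\eta)$, $z(t_0,\eta)=z^0(\eta):=A^\top y^0(\eta)$. Assume that $y^0(\eta)\in\mathrm{Col}(A)$ and $h(AA^\top y^0(\eta),\eta)\in\mathrm{Col}(U)$. Then the error $\Delta\mathcal{H}_j(\eta):=|\mathcal{H}(y^j(\eta),\eta)-\mathcal{H}(Az^j(\eta),\eta)|$ satisfies $$\Delta\mathcal{H}_j(\eta)\le|v^\top(I-\mathbb{P})h(Az^j(\eta),\eta)|+\varepsilon_{\mathcal{H}}^{[t^0,t^j]}+\varepsilon_{\mathcal{H}_{hr}}^{[t^0,t^j]},$$ where $\varepsilon_{\mathcal{H}}^{[t^0,t^j]}:=|\mathcal{H}(y^j(\eta),\eta)-\mathcal{H}(y^0(\eta),\eta)|$ and $\varepsilon_{\mathcal{H}_{hr}}^{[t^0,t^j]}:=|\mathcal{H}_{hr}(z^j(\eta),\eta)-\mathcal{H}_{hr}(z^0(\eta),\eta)|$ are the errors in the Hamiltonian conservation in the temporal interval $[t^0,t^j]$ associated with the chosen temporal integrator.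
   Context: $\mathrm{Col}$ denotes the column space. $\mathcal{P}\subset\mathbb{R}^p$ is a compact parameter set; $t^0=t_0<t^1<\dots<t^{N_t}=T$ are discrete times. $V_{2n}$ is the phase space, a $2n$-dimensional symplectic vector space identified with $\mathbb{R}^{2n}$; $V_{2k}$ is the reduced space, identified with $\mathbb{R}^{2k}$. $J_{2n}=\begin{pmatrix}0&I_n\\-I_n&0\end{pmatrix}$, and $J_{2k}$ is defined analogously. Hamiltonian: $\mathcal{H}(y,\eta)=\tfrac12y^\top L(\eta)y+y^\top f(\eta)+\mathcal{G}(\eta)+\mathcal{N}(y,\eta)$, with $L(\eta)\in\mathbb{R}^{2n\times2n}$ symmetric positive semi-definite, $f(\eta)\in\mathbb{R}^{2n}$, $\mathcal{G}(\eta)\in\mathbb{R}$, $\mathcal{N}(\cdot,\eta)$ nonlinear, and $\nabla_y\mathcal{H}(\cdot,\eta)$ Lipschitz continuous in the Euclidean norm. Reduced basis: $A\in\mathbb{R}^{2n\times2k}$ satisfies $A^\top A=I_{2k}$ and $A^\top J_{2n}A=J_{2k}$. Decomposition: there are a constant vector $v\in\mathbb{R}^d$ and $h:V_{2n}\times\mathcal{P}\to\mathbb{R}^d$ with $\mathcal{N}(Az,\eta)=v^\top h(Az,\eta)$ for all $z\in V_{2k}$, $\eta\in\mathcal{P}$. DEIM projection: $\mathbb{P}=U(P^\top U)^{-1}P^\top\in\mathbb{R}^{d\times d}$, where $U\in\mathbb{R}^{d\times m}$ is the DEIM basis, the columns of $P\in\mathbb{R}^{d\times m}$ are distinct unit vectors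 of $\mathbb{R}^d$, and $P^\top U$ is nonsingular. Hyper-reduced Hamiltonian: $\mathcal{H}_{hr}(z,\eta)=\tfrac12z^\top A^\top L(\eta)Az+z^\top A^\top f(\eta)+\mathcal{G}(\eta)+v^\top\mathbb{P}h(Az,\eta)$. *)

(* Defs.v *)
From HB Require Import structures.
From mathcomp Require Import all_boot all_order all_algebra.
From mathcomp Require Import all_classical all_reals all_analysis.

Set Implicit Arguments.
Unset Strict Implicit.
Unset Printing Implicit Defensive.

Import Order.TTheory GRing.Theory Num.Theory.
Import numFieldNormedType.Exports.

Local Open Scope classical_set_scope.
Local Open Scope ring_scope.

Definition dotv (R : realType) (n : nat) (x y : 'cV[R]_n) : R :=
  (x^T *m y) 0 0.

(* The norm `|x| provided by the library on matrices is the max norm. *)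
Definition enorm (R : realType) (n : nat) (x : 'cV[R]_n) : R :=
  Num.sqrt (dotv x x).

Definition col_space (R : realType) (n k : nat) (M : 'M[R]_(n, k)) :
  set 'cV[R]_n := range (fun x : 'cV[R]_k => M *m x).

Definition symplectic_form (R : realType) (n : nat) : 'M[R]_(n + n) :=
  block_mx 0 1%:M (- 1%:M) 0.

Definition pos_semidef (R : realType) (n : nat) (L : 'M[R]_n) : Prop :=
  L^T = L /\ forall x : 'cV[R]_n, 0 <= dotv x (L *m x).

(* The partial derivatives are the library's total directional derivatives:
   the gradient is meaningful only where f is differentiable. *)
Definition grad (R : realType) (n : nat) (f : 'cV[R]_n -> R)
  (x : 'cV[R]_n) : 'cV[R]_n := \col_i 'D_(delta_mx i 0) f x.

Definition has_lipschitz_grad (R : realType) (n : nat) (f : 'cV[R]_n -> R) :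
  Prop :=
  (forall x, differentiable f x) /\
  exists C : R, forall x y, enorm (grad f x - grad f y) <= C * enorm (x - y).

Definition hamiltonian_field (R : realType) (n : nat)
  (H : 'cV[R]_(n + n) -> R) (x : 'cV[R]_(n + n)) : 'cV[R]_(n + n) :=
  symplectic_form R n *m grad H x.

(* x' = F x on the closed interval [t0, T], x t0 = x0; the derivative is
   one-sided at the end points. *)
Definition ode_solution (R : realType) (n : nat) (F : 'cV[R]_n -> 'cV[R]_n)
  (t0 T : R) (x0 : 'cV[R]_n) (x : R -> 'cV[R]_n) : Prop :=
  x t0 = x0 /\
  forall s : R, s \in `[t0, T] ->
    (r - s)^-1 *: (x r - x s) @[r --> within [set` `[t0, T]] s^'] --> F (x s).

(* An arbitrary time integrator on the grid t^0 < ... < t^Nt: from a vector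
   field, a time grid and an initial state it produces one state per grid
   time.  No consistency, accuracy or structure preservation is required. *)
Record time_integrator (R : realType) (n Nt : nat) := TimeIntegrator {
  integrate :> ('cV[R]_n -> 'cV[R]_n) -> ('I_Nt.+1 -> R) -> 'cV[R]_n ->
               'I_Nt.+1 -> 'cV[R]_n;
  integrate_init : forall F t x0, integrate F t x0 ord0 = x0
}.

Definition hamiltonian (R : realType) (n p : nat)
  (L : 'cV[R]_p -> 'M[R]_(n + n)) (f : 'cV[R]_p -> 'cV[R]_(n + n))
  (G : 'cV[R]_p -> R) (N : 'cV[R]_(n + n) -> 'cV[R]_p -> R)
  (y : 'cV[R]_(n + n)) (eta : 'cV[R]_p) : R :=
  2^-1 * dotv y (L eta *m y) + dotv y (f eta) + G eta + N y eta.

(* The columns of P are distinct vectors of the canonical basis. *)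
Definition selection_matrix (R : realType) (d m : nat) (P : 'M[R]_(d, m)) :
  Prop :=
  exists2 s : 'I_m -> 'I_d, injective s & forall i, col i P = delta_mx (s i) 0.

Definition deim_proj (R : realType) (d m : nat) (U P : 'M[R]_(d, m)) :
  'M[R]_d := U *m invmx (P^T *m U) *m P^T.

Definition hyper_reduced_hamiltonian (R : realType) (n k p d m : nat)
  (L : 'cV[R]_p -> 'M[R]_(n + n)) (f : 'cV[R]_p -> 'cV[R]_(n + n))
  (G : 'cV[R]_p -> R) (v : 'cV[R]_d)
  (h : 'cV[R]_(n + n) -> 'cV[R]_p -> 'cV[R]_d)
  (A : 'M[R]_(n + n, k + k)) (U P : 'M[R]_(d, m))
  (z : 'cV[R]_(k + k)) (eta : 'cV[R]_p) : R :=
  2^-1 * dotv z (A^T *m L eta *m A *m z) + dotv z (A^T *m f eta) + G eta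
  + dotv v (deim_proj U P *m h (A *m z) eta).

(* Main.v *)
Require Import Defs.
From HB Require Import structures.
From mathcomp Require Import all_boot all_order all_algebra.
From mathcomp Require Import all_classical all_reals all_analysis.

Set Implicit Arguments.
Unset Strict Implicit.
Unset Printing Implicit Defensive.

Import Order.TTheory GRing.Theory Num.Theory.
Import numFieldNormedType.Exports.

Local Open Scope classical_set_scope.
Local Open Scope ring_scope.

(* H o A and the hyper-reduced Hamiltonian differ exactly by the DEIM residual
   v^T (I - PP) h (A z).  At the initial state this residual vanishes, because
   PP fixes the column space of U, and A z0 = y0, because A A^T fixes the column
   space of A.  Hence H (y j) - H (A z_j) telescopes through the common initial
   value H y0 = Hhr z0, and the triangle inequality concludes. *)

Lemma dotvBr (R : realType) (n : nat) (x y z : 'cV[R]_n) :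
  dotv x (y - z) = dotv x y - dotv x z.
Proof. by rewrite /dotv mulmxBr !mxE. Qed.

Lemma dotv_mulmxl (R : realType) (n k : nat) (A : 'M[R]_(n, k))
  (x : 'cV[R]_k) (y : 'cV[R]_n) : dotv (A *m x) y = dotv x (A^T *m y).
Proof. by rewrite /dotv trmx_mul mulmxA. Qed.

(** For orthonormal columns, [A *m A^T] is the orthogonal projector onto Col(A): on [A *m x] the
    inner [A^T *m A] cancels. *)
Lemma mulmx_trmx_col_space (R : realType) (n k : nat) (A : 'M[R]_(n, k))
  (y : 'cV[R]_n) :
  A^T *m A = 1%:M -> col_space A y -> A *m (A^T *m y) = y.
Proof. by move=> A_orth [x _ <-]; rewrite (mulmxA A^T) A_orth mul1mx. Qed.

(** On [U *m x] the factor [P^T *m U] meets its inverse, leaving [U *m x]. *)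
Lemma deim_proj_col_space (R : realType) (d m : nat) (U P : 'M[R]_(d, m))
  (y : 'cV[R]_d) :
  P^T *m U \in unitmx -> col_space U y -> deim_proj U P *m y = y.
Proof.
move=> PU_unit [x _ <-].
by rewrite /deim_proj -!mulmxA (mulmxA P^T) mulKmx.
Qed.

(** Moving [A] across [dotv] as [A^T] makes the quadratic, linear and constant terms of both
    Hamiltonians coincide; only the nonlinear terms survive the subtraction. *)
Lemma hamiltonianB_hyper_reduced (R : realType) (n k p d m : nat)
  (L : 'cV[R]_p -> 'M[R]_(n + n)) (f : 'cV[R]_p -> 'cV[R]_(n + n))
  (G : 'cV[R]_p -> R) (N : 'cV[R]_(n + n) -> 'cV[R]_p -> R)
  (v : 'cV[R]_d) (h : 'cV[R]_(n + n) -> 'cV[R]_p -> 'cV[R]_d)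
  (A : 'M[R]_(n + n, k + k)) (U P : 'M[R]_(d, m))
  (z : 'cV[R]_(k + k)) (eta : 'cV[R]_p) :
  N (A *m z) eta = dotv v (h (A *m z) eta) ->
  hamiltonian L f G N (A *m z) eta
    - hyper_reduced_hamiltonian L f G v h A U P z eta
  = dotv v ((1%:M - deim_proj U P) *m h (A *m z) eta).
Proof.
move=> Nh; rewrite /hamiltonian /hyper_reduced_hamiltonian Nh !dotv_mulmxl.
by rewrite mulmxBl mul1mx dotvBr !mulmxA [X in X - _]addrC addrKA.
Qed.

Theorem proposition3p4 (R : realType) (n k p d m Nt : nat)
  (Param : set 'cV[R]_p) (Param_compact : compact Param)
  (t0 T : R) (t : 'I_Nt.+1 -> R)
  (t_first : t ord0 = t0) (t_last : t ord_max = T)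
  (t_incr : forall i j : 'I_Nt.+1, (i < j)%N -> t i < t j)
  (L : 'cV[R]_p -> 'M[R]_(n + n)) (f : 'cV[R]_p -> 'cV[R]_(n + n))
  (G : 'cV[R]_p -> R) (N : 'cV[R]_(n + n) -> 'cV[R]_p -> R)
  (L_psd : forall eta, Param eta -> pos_semidef (L eta))
  (N_nonlinear : forall eta, Param eta -> ~ scalar (N^~ eta))
  (H_lipschitz : forall eta, Param eta ->
     has_lipschitz_grad ((hamiltonian L f G N)^~ eta))
  (A : 'M[R]_(n + n, k + k))
  (A_orth : A^T *m A = 1%:M)
  (A_sympl : A^T *m symplectic_form R n *m A = symplectic_form R k)
  (v : 'cV[R]_d) (h : 'cV[R]_(n + n) -> 'cV[R]_p -> 'cV[R]_d)
  (N_decomp : forall (z : 'cV[R]_(k + k)) eta, Param eta ->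
     N (A *m z) eta = dotv v (h (A *m z) eta))
  (U P : 'M[R]_(d, m))
  (P_sel : selection_matrix P)
  (PU_unit : P^T *m U \in unitmx)
  (eta : 'cV[R]_p) (eta_Param : Param eta)
  (y0 : 'cV[R]_p -> 'cV[R]_(n + n)) :
  let H := hamiltonian L f G N in
  let Hhr := hyper_reduced_hamiltonian L f G v h A U P in
  let PP := deim_proj U P in
  let z0 := fun e => A^T *m y0 e in
  forall
  (Hhr_diff : forall z, differentiable (Hhr^~ eta) z)
  (y_ex : R -> 'cV[R]_(n + n))
  (y_ex_sol : ode_solution (hamiltonian_field (H^~ eta)) t0 T (y0 eta) y_ex)
  (z_ex : R -> 'cV[R]_(k + k))
  (z_ex_sol : ode_solution (hamiltonian_field (Hhr^~ eta)) t0 T (z0 eta) z_ex)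
  (Phi : time_integrator R (n + n) Nt) (Psi : time_integrator R (k + k) Nt),
  let y := Phi (hamiltonian_field (H^~ eta)) t (y0 eta) in
  let z := Psi (hamiltonian_field (Hhr^~ eta)) t (z0 eta) in
  col_space A (y0 eta) ->
  col_space U (h (A *m A^T *m y0 eta) eta) ->
  forall j : 'I_Nt.+1, (0 < j)%N ->
  let DeltaH := `|H (y j) eta - H (A *m z j) eta| in
  let epsH := `|H (y j) eta - H (y ord0) eta| in
  let epsHhr := `|Hhr (z j) eta - Hhr (z ord0) eta| in
  DeltaH <= `|dotv v ((1%:M - PP) *m h (A *m z j) eta)| + epsH + epsHhr.
Proof.
move=> H Hhr PP z0 _ y_ex _ z_ex _ Phi Psi y z y0A hU j _.
have HB w : H (A *m w) eta - Hhr w eta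
    = dotv v ((1%:M - PP) *m h (A *m w) eta).
  by apply: hamiltonianB_hyper_reduced; exact: N_decomp.
(* Both integrators return their initial datum at [ord0], so [z ord0] is the projection of [y0 eta],
   which lifts back without loss. *)
have Az0 : A *m z ord0 = y ord0.
  by rewrite /z /y !integrate_init mulmx_trmx_col_space.
have H0 : H (y ord0) eta = Hhr (z ord0) eta.
  (* With [y ord0] written as a lifted state, the difference becomes the residual of [HB]; [mulmxA]
     gives its argument the shape found in [hU]. *)
  apply/eqP; rewrite -subr_eq0 -Az0 HB /z integrate_init mulmxA.
  by rewrite mulmxBl mul1mx deim_proj_col_space// subrr /dotv mulmx0 mxE.
rewrite /= -HB H0; move: (H (y j) eta) (H (A *m z j) eta).
move: (Hhr (z j) eta) (Hhr (z ord0) eta) => hj h0 Hy HAz.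
(* Two triangle inequalities: from [Hy] to [HAz] through the common initial value [h0], then from
   [h0] to [HAz] through [hj]. *)
rewrite (le_trans (ler_distD h0 _ _))// -addrA addrCA lerD2l.
by rewrite distrC ler_distD.
Qed.
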